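(* Let $\beta>1$ be a real number whose R\'enyi expansion of $1$ is eventually periodic of the form $d_\beta(1)=t_1t_2\cdots t_m(t_{m+1}t_{m+2}\cdots t_{m+p})^\omega$. Suppose the digits $t_1,\ldots,t_{m+p}$ satisfy one of the following: (1) $m=p=1$; (2) $m=1$, $p\geqslant2$, and $t_1>t_2>t_j$ for all $j$ with $2<j\leqslant p+1$; (3) $m\geqslant2$, $t_1>t_2\geqslant t_j$ for all $j$ with $2\leqslant j\leqslant m$, and $t_2>t_j$ for all $j$ with $m+1\leqslant j\leqslant m+p$. If block parallel addition in base $\beta$ can be performed on the alphabet $\mathcal A=\{0,1,\ldots,M\}$, then $M\geqslant 2t_1-t_2-1$.
   Context: R\'enyi expansion of $1$: $r_0=1$, $t_j=\lfloor\beta r_{j-1}\rfloor$, $r_j=\beta r_{j-1}-t_j$ for $j\geqslant1$, and $d_\beta(1)=t_1t_2\cdots$ (so $1=\sum_{j\geqslant1}t_j\beta^{-j}$); $w^\omega$ denotes infinite repetition of the word $w$. For $k\geqslant1$, $\mathcal A_{(k)}=\{a_0+a_1\beta+\cdots+a_{k-1}\beta^{k-1}: a_i\in\mathcal A\}$. A map $\varphi:\mathcal C^{\mathbb Z}\to\mathcal D^{\mathbb Z}$ is $p'$-local if there are $r,t\geqslant0$, $p'=r+t+1$, and $\Phi:\mathcal C^{p'}\to\mathcal D$ with $\varphi(u)_j=\Phi(u_{j+t}\cdots u_{j-r})$ for all $j$. A digit set conversion in base $\delta$ from $\mathcal C$ to $\mathcal D$ is a map $\mathcal C^{\mathbb Z}\to\mathcal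 D^{\mathbb Z}$ sending sequences with finitely many non-zero entries to such sequences and preserving $\sum_j u_j\delta^j$. Block parallel addition in base $\beta$ on $\mathcal A$ is possible if for some $k\geqslant1$ there is a local digit set conversion in base $\beta^k$ from $\mathcal A_{(k)}+\mathcal A_{(k)}$ to $\mathcal A_{(k)}$.
   Formalization: ''Eventually periodic'' is taken to exclude finite expansions (period 0^ω; e.g. β=3, d=3(0)^ω, where addition already works on {0,…,3}), and the alphabet {0,1,…,M} is taken with M≥1 (on {0} addition is trivially possible). *)

(* Defs.v *)
From HB Require Import structures.
From mathcomp Require Import all_boot all_order all_algebra.
From mathcomp Require Import all_classical all_reals.

Set Implicit Arguments.
Unset Strict Implicit.
Unset Printing Implicit Defensive.

Import Order.TTheory GRing.Theory Num.Theory.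
Local Open Scope classical_set_scope.
Local Open Scope ring_scope.

Fixpoint renyi_rem (R : realType) (beta : R) (j : nat) : R :=
  if j is i.+1
  then beta * renyi_rem beta i - (Num.floor (beta * renyi_rem beta i))%:~R
  else 1.

(* The digits are indexed from 1; the value at j = 0 is meaningless. *)
Definition renyi_digit (R : realType) (beta : R) (j : nat) : int :=
  Num.floor (beta * renyi_rem beta j.-1).

Definition renyi_finite (R : realType) (beta : R) : Prop :=
  exists N : nat, forall j : nat, (N < j)%N -> renyi_digit beta j = 0.

(* d_beta(1) = t_1 ... t_m (t_(m+1) ... t_(m+p))^omega.  Following the usual
   dichotomy for Parry numbers, "eventually periodic" excludes the finite
   expansions (those with period 0^omega); m and p need not be minimal. *)
Definition renyi_eventually_periodic (R : realType) (beta : R) (m p : nat) :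
  Prop :=
  [/\ (0 < p)%N,
      forall j : nat, (m < j)%N -> renyi_digit beta (j + p) = renyi_digit beta j
    & ~ renyi_finite beta].

(* The set C^Z of bi-infinite words over the alphabet C. *)
Definition words (R : realType) (C : set R) : set (int -> R) :=
  [set u | forall j, C (u j)].

Definition finitely_supported (R : realType) (u : int -> R) : Prop :=
  finite_set [set j | u j != 0].

(* A map C^Z -> D^Z is represented by a map on all words, of which only the
   restriction to C^Z matters; likewise for Phi : C^q -> D. *)
Definition q_local (R : realType) (C D : set R)
    (phi : (int -> R) -> (int -> R)) (q : nat) : Prop :=
  exists (r t : nat) (Phi : ('I_q -> R) -> R),
    [/\ q = (r + t + 1)%N,
        forall w : 'I_q -> R, (forall i, C (w i)) -> D (Phi w)
      & forall u, words C u ->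
        forall j : int, phi u j = Phi (fun i => u (j + t%:Z - (i : nat)%:Z))].

Definition local_map (R : realType) (C D : set R)
    (phi : (int -> R) -> (int -> R)) : Prop :=
  exists q : nat, q_local C D phi q.

Definition digit_set_conversion (R : realType) (delta : R) (C D : set R)
    (phi : (int -> R) -> (int -> R)) : Prop :=
  (forall u, words C u -> words D (phi u)) /\
  (forall u, words C u -> finitely_supported u ->
     finitely_supported (phi u) /\
     \sum_(j \in [set: int]) (phi u j * delta ^ j)
       = \sum_(j \in [set: int]) (u j * delta ^ j)).

Definition block_alphabet (R : realType) (beta : R) (A : set R) (k : nat) :
  set R :=
  [set x | exists a : 'I_k -> R,
     (forall i, A (a i)) /\ x = \sum_(i < k) a i * beta ^+ i].

Definition sum_alphabet (R : realType) (C D : set R) : set R :=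
  [set x + y | x in C & y in D].

Definition block_parallel_addition (R : realType) (beta : R) (A : set R) :
  Prop :=
  exists k : nat, (0 < k)%N /\
    exists phi : (int -> R) -> (int -> R),
      let Ak := block_alphabet beta A k in
      digit_set_conversion (beta ^+ k) (sum_alphabet Ak Ak) Ak phi /\
      local_map (sum_alphabet Ak Ak) Ak phi.

Definition nat_alphabet (R : realType) (M : nat) : set R :=
  [set a%:R | a in [set a : nat | (a <= M)%N]].

(* Main.v *)
Require Import Defs.
From HB Require Import structures.
From mathcomp Require Import all_boot all_order all_algebra.
From mathcomp Require Import all_classical all_reals.
From mathcomp Require Import zify ring lra.

Import Order.TTheory GRing.Theory Num.Theory.
Local Open Scope classical_set_scope.
Local Open Scope ring_scope.

(* Suppose M < 2 t_1 - t_2 - 1 and put c = t_1 - 1, so that c < beta - 1 and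
   M - c < t_1 - t_2.  Then 0.ccc... has no other representation over
   {0, ..., M}: a larger digit would overshoot because c < beta - 1, and a
   smaller one cannot be compensated because M - c < beta - 1.  In the same way
   the number 0.ccc... - r_j beta^(-n), with r_j the j-th Renyi remainder, can
   only be written c ... c (c - t_(j+1)) (c - t_(j+2)) ..., because
   (1 - r_j) (beta - 1) > t_1 - 1 - t_2 for every j >= 1; this uses only that
   t_2 is maximal among t_2, t_3, ... and positive.  Since
   - r_1 = t_1 - beta, both numbers are values of input words that end in the
   block word x x x ..., x = c^k.  Locality makes the two images agree far
   enough to the right, so that t_j = 0 for all large j, which contradicts the
   infiniteness of d_beta(1).  All of this is carried out on finite words, where
   the truncation of ccc... costs an error that is negligible at high
   positions. *)

(** * Geometric growth and the Rényi expansion of 1 *)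

Lemma exp_unbounded (R : realType) (b x C : R) :
  1 < b -> 0 < x -> exists n : nat, C < b ^+ n * x.
Proof.
move=> b1 x0.
have bernoulli n : 1 + n%:R * (b - 1) <= b ^+ n.
  elim: n => [|n IH]; first by rewrite expr0; lra.
  rewrite exprS -natr1.
  have n0 : 0 <= n%:R * (b - 1) ^+ 2 by rewrite mulr_ge0 ?sqr_ge0.
  have : b * (1 + n%:R * (b - 1)) <= b * b ^+ n by rewrite ler_wpM2l//; lra.
  by move: n0; rewrite expr2; lra.
have C0 : 0 <= `|C| / (x * (b - 1)) by apply: divr_ge0 => //; nra.
have := archi_boundP C0.
set n := Num.bound _; rewrite ltr_pdivrMr; last by nra.
move=> Cn; exists n; have := bernoulli n; have := ler_norm C.
by nra.
Qed.

Lemma renyi_rem_bounds (R : realType) (beta : R) (j : nat) :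
  0 <= renyi_rem beta j.+1 < 1.
Proof.
rewrite /=; set x := beta * _.
have := floor_le x; have := floorD1_gt x; rewrite intrD; lra.
Qed.

Lemma renyi_remS (R : realType) (beta : R) (j : nat) :
  beta * renyi_rem beta j
    = (renyi_digit beta j.+1)%:~R + renyi_rem beta j.+1.
Proof. by rewrite /renyi_digit /=; ring. Qed.

Lemma renyi_rem_ge0 (R : realType) (beta : R) (j : nat) :
  0 <= renyi_rem beta j.
Proof.
by case: j => [|j]; [exact: ler01 | case/andP: (renyi_rem_bounds _ beta j)].
Qed.

Lemma renyi_digit_ge0 (R : realType) (beta : R) (j : nat) :
  0 <= beta -> 0 <= renyi_digit beta j.
Proof. by move=> b0; rewrite floor_ge0 mulr_ge0 ?renyi_rem_ge0. Qed.

(** A vanishing remainder makes all later remainders and digits vanish, so the expansion would be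
    finite. *)
Lemma renyi_rem_gt0 (R : realType) (beta : R) (j : nat) :
  ~ renyi_finite beta -> 0 < renyi_rem beta j.
Proof.
move=> nfin; rewrite lt0r renyi_rem_ge0 andbT; apply/eqP => rj0; apply: nfin.
have rem0 n : renyi_rem beta (j + n) = 0.
  by elim: n => [|n IH]; rewrite ?addn0// addnS /= IH mulr0 floor0 subrr.
exists j => i ji; rewrite /renyi_digit.
have -> : i.-1 = (j + (i.-1 - j))%N by lia.
by rewrite rem0 mulr0 floor0.
Qed.

Lemma eventually_periodic_repr (R : realType) (beta : R) (m p j : nat) :
  renyi_eventually_periodic beta m p -> (m < j)%N ->
  exists2 i : nat, (m + 1 <= i <= m + p)%N
    & renyi_digit beta j = renyi_digit beta i.
Proof.
case=> p0 per _; elim/ltn_ind: j => j IH mj.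
have [jmp|mpj] := leqP j (m + p)%N; first by exists j => //; lia.
have [||i hi ei] := IH (j - p)%N; try lia.
exists i => //; rewrite -ei -(per (j - p)%N); last by lia.
by congr renyi_digit; lia.
Qed.

(** Extracts what the three digit conditions have in common. Periodicity carries each condition to
    all digits. [t_2] is positive because it exceeds some nonnegative digit or, when m = p = 1,
    because the expansion is infinite. *)
Lemma renyi_second_digit_maximal (R : realType) (beta : R) (m p : nat)
  (beta_gt1 : 1 < beta)
  (d_periodic : renyi_eventually_periodic beta m p)
  (d_cases :
    (m = 1%N /\ p = 1%N)
    \/ [/\ m = 1%N, (2 <= p)%N,
           renyi_digit beta 1 > renyi_digit beta 2
         & forall j : nat, (2 < j <= p + 1)%N ->
             renyi_digit beta 2 > renyi_digit beta j]
    \/ [/\ (2 <= m)%N,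
           renyi_digit beta 1 > renyi_digit beta 2,
           forall j : nat, (2 <= j <= m)%N ->
             renyi_digit beta 2 >= renyi_digit beta j
         & forall j : nat, (m + 1 <= j <= m + p)%N ->
             renyi_digit beta 2 > renyi_digit beta j]) :
  [/\ renyi_digit beta 2 < renyi_digit beta 1,
      0 < renyi_digit beta 2
    & forall j : nat, (1 < j)%N -> renyi_digit beta j <= renyi_digit beta 2].
Proof.
have [p0 per nfin] := d_periodic.
have dge0 j : 0 <= renyi_digit beta j by apply: renyi_digit_ge0; lra.
have repr := eventually_periodic_repr _ _ _ _ _ d_periodic.
case: d_cases => [[em ep]|[[em p2 d12 dj]|[m2 d12 djm djp]]].
- have d2 j : (1 < j)%N -> renyi_digit beta j = renyi_digit beta 2.
    move=> j1; have /repr [i hi ->] : (m < j)%N by rewrite em.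
    by congr renyi_digit; lia.
  have t2 : 0 < renyi_digit beta 2.
    rewrite lt0r dge0 andbT; apply/eqP => d20; apply: nfin.
    by exists 1%N => j /d2 ->.
  split=> // [|j /d2 ->//]; rewrite ltNge; apply/negP => d12.
  have d12R : (renyi_digit beta 1)%:~R <= (renyi_digit beta 2)%:~R :> R.
    by rewrite ler_int.
  have /andP[_ r1] := renyi_rem_bounds _ beta 0.
  have r0E := renyi_remS _ beta 0; rewrite [renyi_rem beta 0]/= mulr1 in r0E.
  (* If [t_1 <= t_2], then beta < [t_2] + 1, so r -> beta r - [t_2] expands the distance to 1 at
     least by the factor beta; this would push remainders below 0. *)
  have grow n : beta ^+ n * (1 - renyi_rem beta 1) <= 1 - renyi_rem beta n.+1.
    elim: n => [|n IH]; first by rewrite expr0 mul1r.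
    have rE := renyi_remS _ beta n.+1; rewrite d2// in rE.
    by rewrite exprS -mulrA; nra.
  have [|n] := exp_unbounded _ _ (1 - renyi_rem beta 1) 1 beta_gt1; first by lra.
  have := grow n; have := renyi_rem_ge0 _ beta n.+1; lra.
- have d2 j : (1 < j)%N -> renyi_digit beta j <= renyi_digit beta 2.
    move=> j1; have /repr [i hi ->] : (m < j)%N by rewrite em.
    have [->//|i2] := eqVneq i 2%N.
    by apply: ltW; apply: dj; lia.
  split=> //; have := dj 3%N; have := dge0 3%N; lia.
- have d2 j : (1 < j)%N -> renyi_digit beta j <= renyi_digit beta 2.
    move=> j1; have [jm|mj] := leqP j m; first by apply: djm; lia.
    by case: (repr _ mj) => i hi ->; apply: ltW; apply: djp.
  split=> //; have := djp (m + 1)%N; have := dge0 (m + 1)%N; lia.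
Qed.

(** Expanding the right side with beta = t_1 + r_1 leaves r_2/beta < t_2 - t_(j+2) + r_1 + r_(j+1) -
    r_(j+2) to be shown. The term r_2/beta is a slack independent of j, which later absorbs the
    truncation error. *)
Lemma renyi_margin (R : realType) (beta : R) (j : nat) :
  1 < beta -> 0 < renyi_digit beta 2 ->
  (forall i : nat, (1 < i)%N -> renyi_digit beta i <= renyi_digit beta 2) ->
  (renyi_digit beta 1)%:~R - 1 - (renyi_digit beta 2)%:~R
      + renyi_rem beta 2 / beta
    < (1 - renyi_rem beta j.+1) * (beta - 1).
Proof.
move=> b1 t2 tmax.
have r0E := renyi_remS _ beta 0; rewrite [renyi_rem beta 0]/= mulr1 in r0E.
have r1E := renyi_remS _ beta 1.
have rjE := renyi_remS _ beta j.+1.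
have rj1E := renyi_remS _ beta j.+2.
have /andP[r10 r11] := renyi_rem_bounds _ beta 0.
have /andP[r20 r21] := renyi_rem_bounds _ beta 1.
have /andP[rj0 rj1] := renyi_rem_bounds _ beta j.
have /andP[rS0 rS1] := renyi_rem_bounds _ beta j.+1.
have /andP[rSS0 rSS1] := renyi_rem_bounds _ beta j.+2.
have t2R : 1 <= (renyi_digit beta 2)%:~R :> R by rewrite ler1z -gtz0_ge1.
have tj3 : (renyi_digit beta j.+3)%:~R <= (renyi_digit beta 2)%:~R :> R.
  by rewrite ler_int tmax.
have tj2 : renyi_digit beta j.+2 <= renyi_digit beta 2 by rewrite tmax.
have r2b : renyi_rem beta 2 / beta <= renyi_rem beta 1.
  by rewrite ler_pdivrMr; lra.
(* If t_(j+2) = t_2, multiplying by beta brings in t_(j+3) <= t_2; otherwise the integer gap of at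
   least 1 and r_2/beta <= r_1 suffice. *)
have [eqt|neqt] := eqVneq (renyi_digit beta j.+2) (renyi_digit beta 2).
  rewrite eqt in rjE.
  have key : renyi_rem beta 2 / beta
      < renyi_rem beta 1 + renyi_rem beta j.+1 - renyi_rem beta j.+2.
    by rewrite ltr_pdivrMr; lra.
  by lra.
have tlt : (renyi_digit beta j.+2)%:~R <= (renyi_digit beta 2)%:~R - 1 :> R.
  by rewrite lerBrDr -[1]/(1%:~R) -intrD ler_int lezD1 lt_neqAle neqt.
by lra.
Qed.

(** * Values of bi-infinite words and base-beta digits of blocks *)

Lemma fsum_int_window (R : realType) (F : int -> R) (K N : nat) :
  (forall j : int, F j != 0 -> - K%:Z <= j < N%:Z) ->
  \sum_(j \in [set: int]) F j
    = \sum_(i < K) F (i%:Z - K%:Z) + \sum_(i < N) F i%:Z.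
Proof.
move=> FKN.
rewrite (fsbigE [seq i%:Z - K%:Z | i <- iota 0 (K + N)])//=.
- rewrite (eq_bigl xpredT); last by move=> i; rewrite in_setT.
  rewrite big_map -[X in iota _ X]subn0 big_mkord big_split_ord /=.
  by congr (_ + _); apply: eq_bigr => i _; congr F; lia.
- by rewrite map_inj_uniq ?iota_uniq// => i j; lia.
- move=> j _ jn; apply: contraNeq jn => /FKN jKN.
  by apply/mapP; exists (absz (j + K%:Z)); rewrite ?mem_iota; lia.
Qed.

Lemma finitely_supported_window (R : realType) (u : int -> R) :
  finitely_supported u ->
  exists K : nat, forall j, u j != 0 -> - K%:Z <= j < K%:Z.
Proof.
case/finite_seqP => s es.
exists (\max_(j <- s) (absz j).+1)%N => j uj.
have js : j \in s by have : [set j | u j != 0] j by []; rewrite es.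
have : ((absz j).+1 <= \max_(i <- s) (absz i).+1)%N.
  by apply: (leq_bigmax_seq (F := fun i : int => (absz i).+1)).
by lia.
Qed.

(** Horner's scheme: each further term replaces the sum S by (S + a_K)/delta, and D/(delta - 1) is
    the fixed point of S -> (S + D)/delta. *)
Lemma fraction_bounds (R : realType) (delta D : R) (a : nat -> R) (K : nat) :
  1 < delta -> (forall i, 0 <= a i <= D) ->
  0 <= \sum_(i < K) a i * delta ^ (i%:Z - K%:Z) <= D / (delta - 1).
Proof.
move=> d1 aD; have D0 : 0 <= D by have /andP[] := aD 0%N; exact: le_trans.
elim: K => [|K /andP[IH0 IHD]].
  by rewrite big_ord0 lexx divr_ge0//; lra.
have -> : \sum_(i < K.+1) a i * delta ^ (i%:Z - K.+1%:Z)
    = (\sum_(i < K) a i * delta ^ (i%:Z - K%:Z) + a K) / delta.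
  rewrite big_ord_recr /= mulrDl mulr_suml; congr (_ + _).
    apply: eq_bigr => i _; rewrite -mulrA -[delta^-1]exprN1.
    rewrite -expfzDr; last by rewrite gt_eqF//; lra.
    by congr (_ * delta ^ _); lia.
  by congr (_ * _); rewrite -[delta^-1]exprN1; congr (delta ^ _); lia.
have /andP[aK0 aKD] := aD K.
rewrite divr_ge0 ?addr_ge0//=; last by lra.
rewrite ler_pdivrMr; last by lra.
have -> : D / (delta - 1) * delta = D / (delta - 1) + D.
  by field; rewrite gt_eqF//; lra.
by rewrite lerD.
Qed.

Lemma block_alphabet_digits (R : realType) (beta : R) (M k : nat) (x : R) :
  block_alphabet beta (nat_alphabet M) k x ->
  exists a : nat -> nat, (forall i, (a i <= M)%N) /\
    x = \sum_(i < k) (a i)%:R * beta ^+ i.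
Proof.
case=> a [aA ->].
have /choice [f fP] : forall i, exists n : nat, (n <= M)%N /\ n%:R = a i.
  by move=> i; case: (aA i) => n nM <-; exists n.
exists (fun i => oapp f 0%N (insub i)); split=> [i|].
  by case: insubP => //= j _ _; case: (fP j).
by apply: eq_bigr => i _; rewrite valK /=; case: (fP i) => _ ->.
Qed.

Lemma digits_block_alphabet (R : realType) (beta : R) (M k : nat)
    (a : nat -> nat) :
  (forall i, (a i <= M)%N) ->
  block_alphabet beta (nat_alphabet M) k (\sum_(i < k) (a i)%:R * beta ^+ i).
Proof.
by move=> aM; exists (fun i => (a i)%:R); split=> // i; exists (a i) => /=.
Qed.

Lemma sum_expr (R : realType) (beta : R) (n : nat) :
  1 < beta -> \sum_(i < n) beta ^+ i = (beta ^+ n - 1) / (beta - 1).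
Proof.
by move=> b1; rewrite subrX1 mulrC mulKf// subr_eq0 gt_eqF.
Qed.

Lemma digit_sum_bounds (R : realType) (beta : R) (M k : nat) (a : nat -> nat) :
  1 < beta -> (forall i, (a i <= M)%N) ->
  0 <= \sum_(i < k) (a i)%:R * beta ^+ i
    <= M%:R * ((beta ^+ k - 1) / (beta - 1)).
Proof.
move=> b1 aM; have b0 : 0 <= beta by lra.
rewrite sumr_ge0 => [|i _]; last by rewrite mulr_ge0 ?exprn_ge0.
rewrite -sum_expr// mulr_sumr ler_sum// => i _.
by rewrite ler_wpM2r ?exprn_ge0// ler_nat.
Qed.

Lemma sum_blocks (R : realType) (beta : R) (k n : nat) (w : nat -> R) :
  \sum_(b < n) (\sum_(l < k) w (b * k + l)%N * beta ^+ l) * (beta ^+ k) ^+ b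
    = \sum_(l < n * k) w l * beta ^+ l.
Proof.
elim: n => [|n IH]; first by rewrite mul0n !big_ord0.
rewrite big_ord_recr /= IH mulSnr big_split_ord /=; congr (_ + _).
rewrite mulr_suml; apply: eq_bigr => l _.
by rewrite -mulrA exprD mulnC exprM mulnC [_ * beta ^+ l]mulrC.
Qed.

(** Unfolds an output word into base-beta digits [w] at nonnegative positions and a fractional part
    [f]. Since digits are nonnegative, a value below beta^e leaves no nonzero digit at position e or
    higher. *)
Lemma conversion_digits (R : realType) (beta : R) (M k : nat) (C : set R)
    (phi : (int -> R) -> int -> R) (u : int -> R) :
  1 < beta -> (0 < k)%N ->
  digit_set_conversion (beta ^+ k) C (block_alphabet beta (nat_alphabet M) k)
    phi ->
  words C u -> finitely_supported u ->
  exists (f : R) (w : nat -> nat),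
    [/\ 0 <= f <= M%:R / (beta - 1),
        forall l, (w l <= M)%N,
        forall b : nat,
          phi u b%:Z = \sum_(l < k) (w (b * k + l)%N)%:R * beta ^+ l
      & forall e : nat,
          \sum_(j \in [set: int]) u j * (beta ^+ k) ^ j < beta ^+ e ->
          f + \sum_(l < e) (w l)%:R * beta ^+ l
            = \sum_(j \in [set: int]) u j * (beta ^+ k) ^ j].
Proof.
move=> b1 k0 [phiA phiV] Cu finu.
have b0 : 0 <= beta by lra.
have bk1 : 1 < beta ^+ k by rewrite exprn_egt1// -lt0n.
have [finy <-] := phiV _ Cu finu.
have [K yK] := finitely_supported_window _ _ finy.
have /choice [A AP] : forall j, exists a : nat -> nat,
    (forall i, (a i <= M)%N) /\ phi u j = \sum_(i < k) (a i)%:R * beta ^+ i.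
  by move=> j; exact: block_alphabet_digits (phiA _ Cu j).
pose w l := A (l %/ k)%N%:Z (l %% k)%N.
have wE b : phi u b%:Z = \sum_(l < k) (w (b * k + l)%N)%:R * beta ^+ l.
  have [_ ->] := AP b; apply: eq_bigr => l _.
  by rewrite /w divnMDl// divn_small// addn0 modnMDl modn_small.
pose f := \sum_(i < K) phi u (i%:Z - K%:Z) * (beta ^+ k) ^ (i%:Z - K%:Z).
have VE n : (K <= n)%N -> \sum_(j \in [set: int]) phi u j * (beta ^+ k) ^ j
    = f + \sum_(l < n * k) (w l)%:R * beta ^+ l.
  move=> Kn; rewrite (fsum_int_window _ _ K n) => [|j]; last first.
    by rewrite mulf_eq0 negb_or => /andP[/yK + _]; lia.
  congr (_ + _); rewrite -(sum_blocks _ _ _ _ (fun l => (w l)%:R)).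
  by apply: eq_bigr => i _; rewrite wE.
have fB : 0 <= f <= M%:R / (beta - 1).
  have := fraction_bounds _ (beta ^+ k) (M%:R * ((beta ^+ k - 1) / (beta - 1)))
    (fun i => phi u (i%:Z - K%:Z)) K bk1.
  (* The largest block value divided by beta^k - 1 no longer depends on k. *)
  have -> : M%:R * ((beta ^+ k - 1) / (beta - 1)) / (beta ^+ k - 1)
      = M%:R / (beta - 1).
    by field; rewrite !gt_eqF//; lra.
  apply=> i; have [AM ->] := AP (i%:Z - K%:Z); exact: digit_sum_bounds.
exists f, w; split=> // [l|e Ve]; first exact: (AP _).1.
have [f0 _] := andP fB.
(* Enough blocks both to cover the support and to reach position e. *)
pose n := (K + e)%N.
have en : (e <= n * k)%N by rewrite /n; nia.
rewrite (VE n) ?leq_addr// in Ve *.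
have w0 l : (e <= l < n * k)%N -> w l = 0%N.
  case/andP=> el ln; apply/eqP; rewrite -leqn0 leqNgt; apply/negP => wl.
  suff : beta ^+ e <= \sum_(l < n * k) (w l)%:R * beta ^+ l by lra.
  rewrite (bigD1 (Ordinal ln)) //= -[leLHS]addr0 lerD ?sumr_ge0//; last first.
    by move=> i _; rewrite mulr_ge0 ?exprn_ge0.
  apply: (le_trans (ler_weXn2l (ltW b1) el)).
  by rewrite ler_peMl ?exprn_ge0// ler1n.
rewrite -(subnKC en) big_split_ord /= [X in _ = _ + (_ + X)]big1 ?addr0// => i _.
by rewrite w0 ?mul0r//; have := ltn_ord i; lia.
Qed.

(** * Forcing of digits near the constant word *)

Definition const_sum {R : realType} (beta : R) (c i : nat) : R :=
  \sum_(l < i) c%:R * beta ^+ l.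

Lemma const_sumE (R : realType) (beta : R) (c i : nat) :
  1 < beta -> const_sum beta c i = c%:R * ((beta ^+ i - 1) / (beta - 1)).
Proof. by move=> b1; rewrite -sum_expr// mulr_sumr. Qed.

Lemma const_sum_lt (R : realType) (beta : R) (c i : nat) :
  1 < beta -> c%:R < beta - 1 -> const_sum beta c i < beta ^+ i.
Proof.
move=> b1 cb; have bi : 1 <= beta ^+ i by rewrite exprn_ege1// ltW.
by rewrite const_sumE// mulrA ltr_pdivrMr; [nra | lra].
Qed.

(** Here [tau] is the value below position i. If [w] > c - d, then [tau] < 0, as the constant word
    is below beta^i. If [w] < c - d, then [tau] exceeds what digits up to M can supply. The summand
    c in the margin pays for cutting ccc... off at position 0. *)
Lemma forced_digit (R : realType) (beta tau r : R) (c M w i : nat) (d : int) :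
  1 < beta -> c%:R < beta - 1 ->
  0 <= tau <= M%:R * beta ^+ i / (beta - 1) ->
  0 <= r ->
  (M%:R - c%:R) * beta ^+ i + c%:R < (1 - r) * (beta - 1) * beta ^+ i ->
  tau + w%:R * beta ^+ i
    = const_sum beta c i.+1 - (d%:~R + r) * beta ^+ i ->
  tau = const_sum beta c i - r * beta ^+ i.
Proof.
move=> b1 cb /andP[tau0 tauM] r0 marg.
rewrite /const_sum big_ord_recr /= -/(const_sum beta c i) => eqt.
have B0 : 0 < beta ^+ i by rewrite exprn_gt0//; lra.
have Vlt := const_sum_lt _ _ c i b1 cb.
set B := beta ^+ i in tauM marg eqt B0 Vlt *.
set V := const_sum beta c i in eqt Vlt *.
pose e : int := c%:Z - d - w%:Z.
have eE : tau = V + (e%:~R - r) * B.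
  have -> : e%:~R = c%:R - d%:~R - w%:R :> R by rewrite /e !intrB.
  by lra.
have [e1|e1|e0] := ltgtP e 0.
- have eR : e%:~R <= -1 :> R.
    by rewrite -[-1]/((-1)%:~R) ler_int; lia.
  by nra.
- have eR : 1 <= e%:~R :> R by rewrite ler1z -gtz0_ge1.
  have VE : V * (beta - 1) = c%:R * (B - 1).
    by rewrite /V const_sumE// -/B; field; rewrite gt_eqF//; lra.
  rewrite ler_pdivlMr in tauM; last by lra.
  have : (V + (1 - r) * B) * (beta - 1) <= tau * (beta - 1).
    by rewrite ler_wpM2r ?eE; [|lra|nra].
  by rewrite mulrDl VE; lra.
- by rewrite eE e0; lra.
Qed.

(* The representation is forced from the left: as long as the powers of beta
   dominate the truncation error, its partial sums can only be those of the
   constant word c^i corrected by G i. *)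
Lemma forced_descent (R : realType) (beta f : R) (c M I e : nat)
    (w : nat -> nat) (G : nat -> R) :
  1 < beta -> c%:R < beta - 1 ->
  0 <= f <= M%:R / (beta - 1) -> (forall l, (w l <= M)%N) ->
  (forall i, (I <= i < e)%N -> exists (d : int) (r : R),
    [/\ 0 <= r,
        (M%:R - c%:R) * beta ^+ i + c%:R < (1 - r) * (beta - 1) * beta ^+ i,
        G i = r * beta ^+ i
      & G i.+1 = (d%:~R + r) * beta ^+ i]) ->
  f + \sum_(l < e) (w l)%:R * beta ^+ l = const_sum beta c e - G e ->
  forall i, (I <= i <= e)%N ->
  f + \sum_(l < i) (w l)%:R * beta ^+ l = const_sum beta c i - G i.
Proof.
move=> b1 cb /andP[f0 fM] wM GP tope.
have IH n : forall i, (I <= i <= e)%N -> (e - i <= n)%N ->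
    f + \sum_(l < i) (w l)%:R * beta ^+ l = const_sum beta c i - G i.
  elim: n => [|n IH] i iIe ein; first by have -> : i = e by lia.
  have [->//|ie] := eqVneq i e.
  have [|d [r [r0 marg -> GS]]] := GP i; first by lia.
  have := IH i.+1; rewrite GS big_ord_recr /= addrA => tauS.
  apply: (forced_digit _ _ _ _ _ M (w i) _ d) => //; last by apply: tauS; lia.
  have /andP[s0 sM] := digit_sum_bounds _ beta M i w b1 wM.
  rewrite addr_ge0//=; apply: (le_trans (lerD fM sM)).
  (* The bounds for the fraction and the digits below i add up to exactly M beta^i/(beta - 1). *)
  by rewrite le_eqVlt; apply/orP; left; apply/eqP; field; rewrite gt_eqF//; lra.
by move=> i iIe; apply: (IH (e - i)%N).
Qed.

(** * Finite input words over the sum alphabet *)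

Definition block_word {R : realType} (n : nat) (g : nat -> R) (j : int) : R :=
  if j is Posz b then if (b < n)%N then g b else 0 else 0.

Lemma block_word_value (R : realType) (delta : R) (n : nat) (g : nat -> R) :
  \sum_(j \in [set: int]) block_word n g j * delta ^ j
    = \sum_(b < n) g b * delta ^+ b.
Proof.
rewrite (fsum_int_window _ _ 0 n) => [|[b|b]] /=.
- by rewrite big_ord0 add0r; apply: eq_bigr => b _; rewrite /= ltn_ord.
- by case: ltnP => [bn _|_]; [lia | rewrite mul0r eqxx].
- by rewrite mul0r eqxx.
Qed.

Lemma block_word_finite (R : realType) (n : nat) (g : nat -> R) :
  finitely_supported (block_word n g).
Proof.
apply: (sub_finite_set _ (finite_seq [seq i%:Z | i <- iota 0 n])) => -[b|b] /=.
  case: ltnP => [bn _|_]; last by rewrite eqxx.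
  by apply/mapP; exists b; rewrite ?mem_iota.
by rewrite eqxx.
Qed.

Lemma block_word_words (R : realType) (C : set R) (n : nat) (g : nat -> R) :
  C 0 -> (forall b, (b < n)%N -> C (g b)) -> words C (block_word n g).
Proof. by move=> C0 Cg [b|b] //=; case: ltnP => // /Cg. Qed.

Lemma sum_alphabet_block (R : realType) (beta : R) (M k : nat)
    (a b : nat -> nat) :
  (forall i, (a i <= M)%N) -> (forall i, (b i <= M)%N) ->
  sum_alphabet (block_alphabet beta (nat_alphabet M) k)
    (block_alphabet beta (nat_alphabet M) k)
    (\sum_(i < k) (a i)%:R * beta ^+ i + \sum_(i < k) (b i)%:R * beta ^+ i).
Proof.
move=> aM bM; eexists; first exact: (digits_block_alphabet _ _ _ _ a).
by eexists; first exact: (digits_block_alphabet _ _ _ _ b).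
Qed.

Lemma sum_digit1 (R : realType) (beta : R) (k j a : nat) :
  (j < k)%N ->
  \sum_(i < k) (if i == j :> nat then a else 0%N)%:R * beta ^+ i
    = a%:R * beta ^+ j.
Proof.
move=> jk; rewrite (bigD1 (Ordinal jk)) //= eqxx big1 ?addr0// => i.
by rewrite -val_eqE /= => /negPf ->; rewrite mul0r.
Qed.

(** Otherwise the single block M + 1 <= t_1 < beta must be written with one integer digit, at most
    M, and a fraction at most M/(beta - 1) < 1. *)
Lemma alphabet_ge_floor (R : realType) (beta : R) (M k : nat)
    (phi : (int -> R) -> int -> R) :
  1 < beta -> ~ renyi_finite beta -> (0 < M)%N -> (0 < k)%N ->
  let Ak := block_alphabet beta (nat_alphabet M) k in
  digit_set_conversion (beta ^+ k) (sum_alphabet Ak Ak) Ak phi ->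
  (renyi_digit beta 1)%:~R <= M%:R :> R.
Proof.
move=> b1 nfin M0 k0 Ak conv; rewrite leNgt; apply/negP => Mt.
have r0E := renyi_remS _ beta 0; rewrite [renyi_rem beta 0]/= mulr1 in r0E.
have r10 := renyi_rem_gt0 _ beta 1 nfin.
have Mt1 : M%:R + 1 <= (renyi_digit beta 1)%:~R :> R.
  by move: Mt; rewrite natr1 !pmulrn ltr_int ler_int -lezD1; lia.
have C0 : sum_alphabet Ak Ak 0.
  have := sum_alphabet_block _ beta M k (fun=> 0%N) (fun=> 0%N).
  rewrite big1 => [|i _]; last by rewrite mul0r.
  by rewrite addr0; apply.
have CM : sum_alphabet Ak Ak (M%:R + 1).
  have := sum_alphabet_block _ beta M k
    (fun i => if i == 0 then M else 0)%N (fun i => if i == 0 then 1 else 0)%N.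
  rewrite !sum_digit1// expr0 !mulr1; apply=> i; by case: eqP.
pose u : int -> R := block_word 1 (fun=> M%:R + 1).
have [|f [w [/andP[f0 fM] wM _ wV]]] :=
  conversion_digits _ _ _ _ _ _ u b1 k0 conv _ (block_word_finite _ _ _).
  by apply: block_word_words.
have := wV 1%N; rewrite block_word_value !big_ord1 expr0 !mulr1 expr1 => wV1.
have {wV1} : f + (w 0%N)%:R = M%:R + 1 by apply: wV1; lra.
have : (w 0%N)%:R <= M%:R :> R by rewrite ler_nat.
have : M%:R / (beta - 1) < 1 by rewrite ltr_pdivrMr; lra.
by lra.
Qed.

(** * Comparison of two words with a common tail *)

Lemma const_sum_block (R : realType) (beta : R) (c k b : nat) :
  const_sum beta c (b.+1 * k)
    = const_sum beta c (b * k) + const_sum beta c k * beta ^+ (b * k).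
Proof.
rewrite /const_sum mulSnr big_split_ord /= mulr_suml; congr (_ + _).
by apply: eq_bigr => l _; rewrite -mulrA -exprD addnC.
Qed.

Lemma const_sum_blocks (R : realType) (beta : R) (c k n : nat) :
  \sum_(b < n) const_sum beta c k * (beta ^+ k) ^+ b
    = const_sum beta c (n * k).
Proof. exact: (sum_blocks _ beta k n (fun=> c%:R)). Qed.

Lemma digit_sum_block (R : realType) (beta : R) (k b : nat) (w : nat -> nat) :
  \sum_(l < b.+1 * k) (w l)%:R * beta ^+ l
    = \sum_(l < b * k) (w l)%:R * beta ^+ l
      + (\sum_(l < k) (w (b * k + l)%N)%:R * beta ^+ l) * beta ^+ (b * k).
Proof.
rewrite mulSnr big_split_ord /= mulr_suml; congr (_ + _).
by apply: eq_bigr => l _; rewrite -mulrA -exprD addnC.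
Qed.

(* The images of the words x^n and (x - 1)(x + t_1 beta^(k-1)) x^n, with x the
   block c^k, have the same blocks far to the right; the partial sums of the
   second one fall short of those of x^n by r_(g k) beta^(b k). *)
Lemma forced_remainder_growth (R : realType) (beta : R) (c M k r t : nat)
    (phi : (int -> R) -> int -> R) (Phi : ('I_(r + t + 1) -> R) -> R) :
  1 < beta -> ~ renyi_finite beta -> (0 < k)%N -> (0 < c)%N ->
  (renyi_digit beta 1 = c.+1%:Z) -> (c < M)%N ->
  0 < renyi_digit beta 2 ->
  (forall i : nat, (1 < i)%N -> renyi_digit beta i <= renyi_digit beta 2) ->
  (M%:R - c%:R <= c%:R - (renyi_digit beta 2)%:~R :> R) ->
  let Ak := block_alphabet beta (nat_alphabet M) k in
  let C := sum_alphabet Ak Ak in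
  digit_set_conversion (beta ^+ k) C Ak phi ->
  (forall u, words C u -> forall j : int,
    phi u j = Phi (fun i => u (j + t%:Z - (i : nat)%:Z))) ->
  forall g : nat, (t < g)%N ->
  renyi_rem beta (g.+1 * k) = beta ^+ k * renyi_rem beta (g * k).
Proof.
move=> b1 nfin k0 c0 t1E cM t20 tmax Mc Ak C conv loc g tg.
have r0E := renyi_remS _ beta 0; rewrite [renyi_rem beta 0]/= mulr1 t1E in r0E.
have {}r0E : beta = c%:R + 1 + renyi_rem beta 1 by rewrite natr1.
have r10 := renyi_rem_gt0 _ beta 1 nfin.
have r20 := renyi_rem_gt0 _ beta 2 nfin.
have b0 : 0 < beta by lra.
have cb : c%:R < beta - 1 by lra.
have eps0 : 0 < renyi_rem beta 2 / beta by apply: divr_gt0.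
(* From position [I] on, the slack r_2/beta, scaled by beta^i, outweighs the truncation error c. *)
have [I IP] := exp_unbounded _ beta _ c%:R b1 eps0.
have margin i s j : (I <= i)%N -> 0 <= s -> s <= renyi_rem beta j.+1 ->
    (M%:R - c%:R) * beta ^+ i + c%:R < (1 - s) * (beta - 1) * beta ^+ i.
  move=> Ii s0 sj; have B0 : 0 < beta ^+ i by rewrite exprn_gt0.
  have cB : c%:R < renyi_rem beta 2 / beta * beta ^+ i.
    apply: (lt_le_trans IP); rewrite mulrC ler_wpM2l//; first exact: ltW.
    by apply: ler_weXn2l => //; exact: ltW.
  have := renyi_margin _ beta j b1 t20 tmax; rewrite t1E => mj.
  have {}mj : M%:R - c%:R + renyi_rem beta 2 / beta < (1 - s) * (beta - 1).
    have : (1 - renyi_rem beta j.+1) * (beta - 1) <= (1 - s) * (beta - 1).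
      by rewrite ler_wpM2r; lra.
    by move: mj; rewrite -[c.+1%:Z%:~R]/(c.+1%:R) -natr1; lra.
  have := ltr_pM2r B0 (M%:R - c%:R + renyi_rem beta 2 / beta)
    ((1 - s) * (beta - 1)); rewrite mj mulrDl; lra.
pose x : R := const_sum beta c k.
have digits_in (a b : nat -> nat) :
    (forall i, (a i <= M)%N) -> (forall i, (b i <= M)%N) ->
    C (\sum_(i < k) (a i)%:R * beta ^+ i + \sum_(i < k) (b i)%:R * beta ^+ i).
  exact: sum_alphabet_block.
have z0 : \sum_(i < k) 0%:R * beta ^+ i = 0 :> R.
  by rewrite big1// => i _; rewrite mul0r.
have C0 : C 0.
  by have := digits_in (fun=> 0%N) (fun=> 0%N); rewrite z0 addr0; apply.
have Cx : C x.
  have := digits_in (fun=> c) (fun=> 0%N); rewrite z0 addr0; apply=> // _.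
  exact: ltnW.
have Cx1 : C (x - 1).
  have := digits_in (fun i => c - (i == 0)%N)%N (fun=> 0%N); rewrite z0 addr0.
  have -> : \sum_(i < k) (c - (i == 0 :> nat))%N%:R * beta ^+ i = x - 1.
    have e1 := sum_digit1 _ beta k 0 1 k0; rewrite expr0 mulr1 in e1.
    rewrite /x /const_sum -[X in _ - X]e1 -sumrB; apply: eq_bigr => i _.
    case: eqP => _ /=; first by rewrite natrB// mulrBl.
    by rewrite subn0 mul0r subr0.
  by apply=> // i; apply: leq_trans (leq_subr _ _) (ltnW cM).
have Cxt : C (x + c.+1%:R * beta ^+ k.-1).
  have := digits_in (fun=> c) (fun i => if i == k.-1 then c.+1 else 0)%N.
  rewrite sum_digit1; last by rewrite prednK.
  by apply=> [_|i]; [exact: ltnW | case: eqP].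
pose y := Phi (fun=> x).
have yE n h b : words C (block_word n h) -> (r <= b)%N -> (b + t < n)%N ->
    (forall j, (j <= b + t)%N -> h j = x) -> phi (block_word n h) b%:Z = y.
  move=> Cw rb btn hx; rewrite loc//; congr Phi; apply/funext => i.
  have -> : b%:Z + t%:Z - i%:Z = (b + t - i)%N%:Z.
    by move: (ltn_ord i) rb; clear; lia.
  rewrite /= (leq_ltn_trans (leq_subr _ _) btn).
  by apply: hx; exact: leq_subr.
have yx : y = x.
  (* The offset r keeps the window of block b inside the word; the offset I puts b where digits are
     forced. *)
  pose b := (r + I)%N; pose n := (b + t + 1)%N.
  have Cu : words C (block_word n (fun=> x)) by apply: block_word_words.
  have [f [w [fB wM wE wV]]] :=
    conversion_digits _ _ _ _ _ _ _ b1 k0 conv Cu (block_word_finite _ _ _).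
  have := wV (n * k)%N; rewrite block_word_value const_sum_blocks.
  move=> /(_ (const_sum_lt _ _ _ _ b1 cb)); rewrite -[RHS]subr0 => top.
  have desc := forced_descent _ _ f c M I _ w (fun=> 0) b1 cb fB wM _ top.
  have Ib : (I <= b * k)%N by rewrite /b; clear -k0; nia.
  have bn : (b.+1 * k <= n * k)%N by rewrite leq_mul2r /n; clear; lia.
  have {desc}tau i : (I <= i <= n * k)%N ->
      f + \sum_(l < i) (w l)%:R * beta ^+ l = const_sum beta c i.
    move=> iI; rewrite desc ?subr0// => l /andP[Il _]; exists 0, 0; split=> //.
    - by apply: (margin _ _ 0%N) => //; exact: ltW.
    - by rewrite mul0r.
    - by rewrite addr0 mul0r.
  have := tau (b.+1 * k)%N; have := tau (b * k)%N.
  rewrite digit_sum_block const_sum_block addrA -wE (yE _ _ b Cu)//; last 2 first.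
  - exact: leq_addr.
  - by rewrite /n; clear; lia.
  move=> -> ; last by move: Ib bn; clear; lia.
  move=> /(_ _) e; have /addrI : const_sum beta c (b * k) + y * beta ^+ (b * k)
     = const_sum beta c (b * k) + x * beta ^+ (b * k).
    by apply: e; move: Ib bn; clear; lia.
  by apply: mulIf; rewrite expf_neq0// gt_eqF.
(* As g > t, the modified blocks b2 and b2 + 1 lie outside the window of block b. [F] is the top
   position of block b2, where t_1 is added. *)
pose b := (r + I)%N; pose b2 := (b + g)%N.
pose F := (b2 * k + k.-1)%N.
pose h j : R := x + if j == b2.+1 then -1 else
  if j == b2 then c.+1%:R * beta ^+ k.-1 else 0.
have Cu : words C (block_word b2.+2 h).
  apply: block_word_words => // j _; rewrite /h.
  by case: eqP => // _; case: eqP => // _; rewrite addr0.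
have [f [w [fB wM wE wV]]] :=
  conversion_digits _ _ _ _ _ _ _ b1 k0 conv Cu (block_word_finite _ _ _).
(* The two modifications contribute t_1 beta^F - beta^(F+1) = -r_1 beta^F. *)
have vE : \sum_(j < b2.+2) h j * (beta ^+ k) ^+ j
    = const_sum beta c (b2.+2 * k) - renyi_rem beta 1 * beta ^+ F.
  have r1E : renyi_rem beta 1 = beta - c.+1%:R by rewrite -natr1; lra.
  rewrite r1E -const_sum_blocks !big_ord_recr /= -/x /h !eqxx.
  rewrite (ltn_eqF (ltnSn b2)).
  have -> : \sum_(i < b2) (x + (if i == b2.+1 :> nat then -1
      else if i == b2 :> nat then c.+1%:R * beta ^+ k.-1 else 0))
        * (beta ^+ k) ^+ i = \sum_(i < b2) x * (beta ^+ k) ^+ i.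
    by apply: eq_bigr => i _; rewrite !ltn_eqF ?addr0// ltnS ltnW.
  have -> : beta ^+ F = (beta ^+ k) ^+ b2 * beta ^+ k.-1.
    by rewrite exprD mulnC exprM.
  rewrite [(beta ^+ k) ^+ b2.+1]exprS.
  have -> : beta ^+ k = beta * beta ^+ k.-1 by rewrite -exprS prednK.
  by ring.
have rF : 0 <= renyi_rem beta 1 * beta ^+ F.
  by rewrite mulr_ge0 ?exprn_ge0// ltW.
have top := wV (b2.+2 * k)%N; rewrite block_word_value vE in top.
have {}top : f + \sum_(l < b2.+2 * k) (w l)%:R * beta ^+ l
    = const_sum beta c (b2.+2 * k) - renyi_rem beta 1 * beta ^+ F.
  by apply: top; have := const_sum_lt _ _ c (b2.+2 * k) b1 cb; lra.
(* Below F the deficit follows the Rényi recursion, one remainder per position; above F it stays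
   constant, so the forced digits there are c. *)
pose G i : R := if (i <= F)%N then renyi_rem beta (F - i).+1 * beta ^+ i
  else renyi_rem beta 1 * beta ^+ F.
have GF : G (b2.+2 * k)%N = renyi_rem beta 1 * beta ^+ F.
  by rewrite /G ifF//; apply/negbTE; rewrite -ltnNge /F; clear -k0; nia.
rewrite -GF in top.
have GP i : (I <= i < b2.+2 * k)%N -> exists (d : int) (s : R),
    [/\ 0 <= s,
        (M%:R - c%:R) * beta ^+ i + c%:R < (1 - s) * (beta - 1) * beta ^+ i,
        G i = s * beta ^+ i
      & G i.+1 = (d%:~R + s) * beta ^+ i].
  case/andP=> Ii _; rewrite /G; have [iF|Fi] := leqP i F; last first.
    have bF : renyi_rem beta 1 * beta ^+ F
        = renyi_rem beta 1 / beta ^+ (i - F) * beta ^+ i.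
      have -> : beta ^+ i = beta ^+ F * beta ^+ (i - F).
        by rewrite -exprD subnKC// ltnW.
      by field; rewrite expf_neq0// gt_eqF.
    have s1 : 1 <= beta ^+ (i - F) by rewrite exprn_ege1// ltW.
    exists 0, (renyi_rem beta 1 / beta ^+ (i - F)); split=> //.
    - by rewrite divr_ge0 ?exprn_ge0// ltW.
    - apply: (margin _ _ 0%N) => //; first by rewrite divr_ge0 ?exprn_ge0// ltW.
      by rewrite ler_pdivrMr ?ler_peMr//; [exact: ltW | lra].
    - by rewrite ifF ?add0r//; apply/negbTE; rewrite -ltnNge ltnS ltnW.
  have remF : beta * renyi_rem beta (F - i)
      = (renyi_digit beta (F - i).+1)%:~R + renyi_rem beta (F - i).+1.
    exact: renyi_remS.
  have [eFi|nFi] := eqVneq i F.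
    exists 0, (renyi_rem beta 1); split=> //; first exact: ltW.
    - by apply: (margin _ _ 0%N) => //; exact: ltW.
    - by rewrite eFi subnn.
    - by rewrite ifF ?eFi ?add0r// ltnn.
  exists (renyi_digit beta (F - i).+1), (renyi_rem beta (F - i).+1).
  split=> //; first exact: renyi_rem_ge0.
  - by apply: (margin _ _ (F - i)%N) => //; exact: renyi_rem_ge0.
  - have -> : (i.+1 <= F)%N by rewrite ltn_neqAle nFi.
    have -> : (F - i.+1).+1 = (F - i)%N by move: iF nFi; clear; lia.
    by rewrite -remF exprS; ring.
have tau := forced_descent _ _ f c M I _ w G b1 cb fB wM GP top.
(* Block b of the image equals x, so the deficits at its two ends coincide; they are r_((g+1)k)
   beta^(bk) and r_(gk) beta^((b+1)k). *)
have := tau (b.+1 * k)%N; have := tau (b * k)%N.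
rewrite digit_sum_block const_sum_block addrA -wE (yE _ _ b Cu)//; first last.
- move=> j jbt; rewrite /h !ltn_eqF ?addr0//; move: jbt tg; rewrite /b2; clear; lia.
- by move: tg; rewrite /b2; clear; lia.
- exact: leq_addr.
rewrite yx => ->; last by rewrite /b2 /b; clear -k0; nia.
move=> /(_ _) e.
have {e} : const_sum beta c (b * k) - G (b * k)%N + x * beta ^+ (b * k)
    = const_sum beta c (b * k) + x * beta ^+ (b * k) - G (b.+1 * k)%N.
  by apply: e; move: tg; rewrite /b2 /b; clear -k0; nia.
have -> : G (b * k)%N = renyi_rem beta (g.+1 * k) * beta ^+ (b * k).
  rewrite /G ifT; last by rewrite /F /b2; clear -k0 tg; nia.
  by congr (renyi_rem _ _ * _); rewrite /F /b2; clear -k0 tg; nia.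
have -> : G (b.+1 * k)%N = beta ^+ k * renyi_rem beta (g * k) * beta ^+ (b * k).
  rewrite /G ifT; last by rewrite /F /b2; clear -k0 tg; nia.
  rewrite mulSnr exprD mulrCA mulrA mulrC mulrA.
  have -> : (F - (b * k + k)).+1 = (g * k)%N by rewrite /F /b2; clear -k0 tg; nia.
  by ring.
move=> e; have B0 : beta ^+ (b * k) != 0 by rewrite expf_neq0// gt_eqF.
by apply: (mulIf B0); move: e; lra.
Qed.

(** * Unbounded growth of the remainders as the contradiction *)

Theorem theorem16 (R : realType) (beta : R) (m p M : nat)
  (beta_gt1 : 1 < beta)
  (d_periodic : renyi_eventually_periodic beta m p)
  (d_cases :
    (m = 1%N /\ p = 1%N)
    \/ [/\ m = 1%N, (2 <= p)%N,
           renyi_digit beta 1 > renyi_digit beta 2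
         & forall j : nat, (2 < j <= p + 1)%N ->
             renyi_digit beta 2 > renyi_digit beta j]
    \/ [/\ (2 <= m)%N,
           renyi_digit beta 1 > renyi_digit beta 2,
           forall j : nat, (2 <= j <= m)%N ->
             renyi_digit beta 2 >= renyi_digit beta j
         & forall j : nat, (m + 1 <= j <= m + p)%N ->
             renyi_digit beta 2 > renyi_digit beta j])
  (M_gt0 : (0 < M)%N)
  (addA : block_parallel_addition beta (nat_alphabet M)) :
  M%:Z >= 2 * renyi_digit beta 1 - renyi_digit beta 2 - 1.
Proof.
have [_ _ nfin] := d_periodic.
have [t12 t20 tmax] :=
  renyi_second_digit_maximal _ _ _ _ beta_gt1 d_periodic d_cases.
case: addA => k [k0 [phi [conv [q [r [t [Phi [eq_q _ loc]]]]]]]].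
rewrite leNgt; apply/negP => Mlt; subst q.
have t1M : renyi_digit beta 1 <= M%:Z.
  rewrite -(ler_int R).
  exact: (alphabet_ge_floor _ _ _ _ _ beta_gt1 nfin M_gt0 k0 conv).
pose c := (absz (renyi_digit beta 1)).-1.
have t1E : renyi_digit beta 1 = c.+1%:Z by move: t12 t20; rewrite /c; clear; lia.
have c0 : (0 < c)%N by move: t1E t12 t20; clear; lia.
have cM : (c < M)%N by move: t1E t1M; clear; lia.
(* Integrality turns M - c < t_1 - t_2 into M - c <= c - t_2. *)
have Mc : M%:R - c%:R <= c%:R - (renyi_digit beta 2)%:~R :> R.
  have : M%:Z - c%:Z <= c%:Z - renyi_digit beta 2.
    by move: Mlt; rewrite t1E; clear; lia.
  by rewrite -(ler_int R) !intrB.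
have grow := forced_remainder_growth _ _ c M k r t phi Phi beta_gt1 nfin k0 c0
  t1E cM t20 tmax Mc conv loc.
have growX n : renyi_rem beta ((n + t.+1) * k)
    = (beta ^+ k) ^+ n * renyi_rem beta (t.+1 * k).
  elim: n => [|n IH]; first by rewrite add0n expr0 mul1r.
  rewrite addSn grow ?IH ?exprS ?mulrA//.
  by rewrite addnS ltnS leq_addl.
have bk1 : 1 < beta ^+ k by rewrite exprn_egt1// -lt0n.
have [n] := exp_unbounded _ _ _ 1 bk1 (renyi_rem_gt0 _ _ (t.+1 * k) nfin).
rewrite -growX.
(* The bound r_j < 1 is available only for j >= 1, since r_0 = 1. *)
have -> : ((n + t.+1) * k = ((n + t.+1) * k).-1.+1)%N.
  by rewrite prednK// muln_gt0 addnS.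
have /andP[_] := renyi_rem_bounds _ beta ((n + t.+1) * k).-1.
by lra.
Qed.
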